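(* Let $n\ge 1$, $0<p<1$, $1\le m\le n$, $k\in\mathbb N$ and $t>0$. Let $V=\{1,\dots,n\}$ and let $G(n,p)$ be the random graph on $V$. Then there exists an integer $a$ such that $$P\big(\chi(G(n,p),m)\in[a-k,a]\big)\ge1-2e^{-t^2/8}-P\big(\sup\{\chi(G(n,p),F): F\subset V,\ \mathrm{card}\,F\le t\sqrt m\}>k\big).$$
   Context: A graph $G$ on the vertex set $V=\{1,\dots,n\}$ is a subset of $\{(i,j): 1\le i<j\le n\}$; $i<j$ are linked by an edge if $(i,j)\in G$. The random graph $G(n,p)$ is obtained by putting each possible edge $(i,j)$ in $G$ with probability $p$, independently of the other edges. A subset of $V$ is called independent if no two of its points are linked by an edge. For $A\subset V$, $\chi(G,A)$ is the smallest number of independent sets that can cover $A$, and $$\chi(G,m)=\inf\{\chi(G,A): A\subset V,\ \mathrm{card}\,A=m\}.$$ *)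

(* Defs.v *)
From mathcomp Require Import all_boot all_order all_algebra.
From mathcomp Require Import reals.

Set Implicit Arguments.
Unset Strict Implicit.
Unset Printing Implicit Defensive.

Import Order.TTheory GRing.Theory Num.Theory.

Definition edge_slots (n : nat) : {set 'I_n * 'I_n} :=
  [set e : 'I_n * 'I_n | e.1 < e.2].

Definition graph (n : nat) : Type :=
  {G : {set 'I_n * 'I_n} | G \subset edge_slots n}.

(* Since pairs in a graph are increasing, letting (i, j) range over both
   orders covers every unordered pair. *)
Definition independent (n : nat) (G : graph n) (A : {set 'I_n}) : bool :=
  [forall i in A, forall j in A, (i, j) \notin val G].

Definition ind_cover (n : nat) (G : graph n) (A : {set 'I_n}) (c : nat) : bool :=
  [exists C : {set {set 'I_n}},
    [&& #|C| == c, [forall S in C, independent G S] & A \subset cover C]].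

Lemma ind_cover_singletons (n : nat) (G : graph n) (A : {set 'I_n}) :
  ind_cover G A #|A|.
Proof.
apply/existsP; exists [set [set i] | i in A]; apply/and3P; split.
- by rewrite card_imset //; apply: set1_inj.
- apply/forall_inP => _ /imsetP[i _ ->].
  apply/forall_inP => x /set1P->; apply/forall_inP => y /set1P->.
  apply/negP => /(subsetP (valP G)); by rewrite inE /= ltnn.
- apply/subsetP => i iA; apply/bigcupP; exists [set i]; last exact: set11.
  exact: imset_f.
Qed.

Lemma ex_ind_cover (n : nat) (G : graph n) (A : {set 'I_n}) :
  exists c, ind_cover G A c.
Proof. by exists #|A|; apply: ind_cover_singletons. Qed.

Definition chi (n : nat) (G : graph n) (A : {set 'I_n}) : nat :=
  ex_minn (ex_ind_cover G A).

Lemma chi_le_n (n : nat) (G : graph n) (A : {set 'I_n}) : chi G A <= n.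
Proof.
rewrite /chi; case: ex_minnP => c _ /(_ _ (ind_cover_singletons G A)) cA.
by apply: (leq_trans cA); rewrite -[leqRHS]card_ord max_card.
Qed.

(* By chi_le_n, the default value n does not affect the minimum as soon as
   some A has cardinality m, i.e. when m <= n. *)
Definition chi_inf (n : nat) (G : graph n) (m : nat) : nat :=
  \big[minn/n]_(A : {set 'I_n} | #|A| == m) chi G A.

Local Open Scope ring_scope.

(* The default value 0 of \max is immaterial: chi is a natural number, and
   F = set0 is admissible whenever x >= 0. *)
Definition chi_sup (R : realType) (n : nat) (G : graph n) (x : R) : nat :=
  (\max_(F : {set 'I_n} | (#|F|%:R <= x)%R) chi G F)%N.

Definition gnp_mass (R : realType) (n : nat) (p : R) (G : graph n) : R :=
  \prod_(e in edge_slots n) (if e \in val G then p else 1 - p).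

Definition gnp_prob (R : realType) (n : nat) (p : R) (E : pred (graph n)) : R :=
  \sum_(G : graph n | E G) gnp_mass p G.

(* The edges of G(n, p) are mutually independent, each of probability p;
   S = set0 says that the total mass is 1. *)
Lemma gnp_prob_edges (R : realType) (n : nat) (p : R) (S : {set 'I_n * 'I_n}) :
  S \subset edge_slots n ->
  gnp_prob p (fun G : graph n => S \subset val G) = p ^+ #|S|.
Proof.
move=> SE; rewrite /gnp_prob /gnp_mass.
pose F e : R := if e \in edge_slots n then p else 0.
pose H e : R := if e \in S then 0 else if e \in edge_slots n then 1 - p else 1.
have FHE : \prod_e (F e + H e) = p ^+ #|S|.
  rewrite (bigID (mem S)) /= [X in _ * X]big1 ?mulr1; last first.
    move=> e eS; rewrite /F /H (negbTE eS).
    by case: ifP => _; rewrite ?add0r ?subrKC.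
  rewrite -prodr_const; apply: eq_bigr => e eS.
  by rewrite /F /H eS (subsetP SE) // addr0.
pose Q (J : {set 'I_n * 'I_n}) := (J \subset edge_slots n) && (S \subset J).
rewrite -FHE bigA_distr (bigID Q) /=.
rewrite [X in _ = _ + X]big1 ?addr0; last first.
  move=> J; rewrite /Q negb_and => /orP[] /subsetPn[e e1 e2]; rewrite (bigD1 e) //=.
    by rewrite e1 /F (negbTE e2) mul0r.
  by rewrite (negbTE e2) /H e1 mul0r.
transitivity (\sum_(J : {set 'I_n * 'I_n} | Q J)
    \prod_(e in edge_slots n) (if e \in J then p else 1 - p)).
  by rewrite [RHS]big_sub_cond.
apply: eq_bigr => J /andP[JE SJ]; rewrite big_mkcond /=; apply: eq_bigr => e _.
rewrite /F /H; case: ifP => eE; case: ifP => eJ //.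
- by rewrite ifN //; apply/negP => /(subsetP SJ); rewrite eJ.
- by move: (subsetP JE _ eJ); rewrite eE.
- by rewrite ifN //; apply/negP => /(subsetP SJ); rewrite eJ.
Qed.

(* Main.v *)
(* Expose the vertices one at a time: vertex j reveals the set of i < j linked
   to it, so G(n, p) is a product space with n coordinates. If chi(G, m) <= b
   is witnessed by a set B of size m, and every set of at most t sqrt m vertices
   is k-colourable in H, then chi(H, m) > b + k forces the rows of G and H to
   differ at more than t sqrt m vertices of B. By Talagrand's convex distance
   inequality, {chi(., m) <= b} and {chi(., m) > b + k, sup <= k} then have
   probabilities whose product is at most exp(-t^2/4). Take b minimal with
   P(chi(., m) <= b) > exp(-t^2/8), and a = b + k. *)
Require Import Defs.
From mathcomp Require Import all_boot all_order all_algebra.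
From mathcomp Require Import boolp reals sequences exp normedtype derive realfun ring lra.
Import Order.TTheory GRing.Theory Num.Theory numFieldNormedType.Exports.
Local Open Scope ring_scope.

Set Implicit Arguments.
Unset Strict Implicit.
Unset Printing Implicit Defensive.

(** * Scalar inequalities for the exponential *)

(** This is the estimate behind [talagrand_lambda], with [r = expR (- L)] and [l = 1 - 2 * L]. The
    gap between the two sides vanishes at 0 and has a nonnegative derivative. *)
Lemma expR_sub_sqr (R : realType) (L : R) :
  0 <= L -> expR (L - L ^+ 2) + expR (- L) <= 2.
Proof.
rewrite le_eqVlt => /predU1P[<-|L0]; first by rewrite expr0n subr0 oppr0 expR0; lra.
pose h (x : R) : R := 2 - expR (x - x ^+ 2) - expR (- x).
pose h' (x : R) : R := expR (- x) - (1 - 2 * x) * expR (x - x ^+ 2).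
have hD (x : R) : is_derive x (1 : R) h (h' x).
  rewrite /h /h'; apply: is_derive_eq.
  rewrite /GRing.scale/=.
  ring.
have [] := @MVT R h h' 0 L L0 (fun x _ => hD x).
  apply: derivable_within_continuous => x _.
  by have := hD x; case.
move=> c; rewrite in_itv/= => /andP[c0 cL].
rewrite /h expr0n subr0 oppr0 expR0 => hE.
have h'c : 0 <= h' c.
  rewrite /h' subr_ge0.
  have [lc|lc] := leP (1 - 2 * c) 0.
    by rewrite (@le_trans _ _ 0) ?expR_ge0// mulr_le0_ge0// expR_ge0.
  (* The factor [1 - 2 * c] is at most [expR (- (2 * c))], and [c - c ^+ 2 <= c] bounds the other
     one. *)
  have -> : - c = - (2 * c) + c by ring.
  rewrite [leRHS]expRD; apply: ler_pM; [exact: ltW|exact: expR_ge0|exact: expR_ge1Dx|].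
  by rewrite ler_expR gerBl sqr_ge0.
have := mulr_ge0 h'c (ltW L0); rewrite -[L in h' c * L]addr0 -hE; lra.
Qed.

(** Average the tangent-line bounds at the mixed point [z]: the linear terms cancel. *)
Lemma convex_expR_le (R : realType) (l x y : R) : 0 <= l <= 1 ->
  expR (l * x + (1 - l) * y) <= l * expR x + (1 - l) * expR y.
Proof.
move=> /andP[l0 l1]; set z := l * x + _.
have tangent u : expR z * (1 + (u - z)) <= expR u.
  by rewrite -[in leRHS](subrKC z u) [leRHS]expRD ler_wpM2l ?expR_ge0// expR_ge1Dx.
have /lerD := ler_wpM2l l0 (tangent x).
have l1' : 0 <= 1 - l by rewrite subr_ge0.
move=> /(_ _ _ (ler_wpM2l l1' (tangent y))); apply: le_trans.
rewrite le_eqVlt; apply/orP; left; apply/eqP; move: (expR z) => E; rewrite /z; ring.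
Qed.

(* For r >= exp(-1/2) the minimizer is l = 1 + 2 ln r; below, l = 0 suffices.
   The clause on r = 0 makes up for the junk value ln 0 = 0. *)
Lemma talagrand_lambda (R : realType) (r : R) : 0 <= r <= 1 ->
  exists l : R, [/\ 0 <= l <= 1, r = 0 -> l = 0 &
    expR ((1 - l) ^+ 2 / 4 - l * ln r) <= 2 - r].
Proof.
have e14 : expR (1 / 4) <= 4 / 3 :> R.
  have := expRxMexpNx_1 (1 / 4 : R); have := expR_ge1Dx (- (1 / 4) : R).
  have := expR_gt0 (1 / 4 : R); nra.
move=> /andP[]; rewrite le_eqVlt => /predU1P[<- _|r0 r1].
  by exists 0; split=> //; rewrite ?lexx ?ler01// subr0 expr1n mul0r !subr0; lra.
have [L2|L2] := leP (- ln r) (1 / 2).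
  have L0 : 0 <= - ln r by rewrite oppr_ge0 ln_le0.
  exists (1 + 2 * ln r); split; [lra|by move=> r_eq0; rewrite r_eq0 ltxx in r0|].
  have := expR_sub_sqr L0; rewrite opprK lnK ?posrE// -lerBrDr.
  by congr (expR _ <= _); field.
(* Here [- ln r > 1 / 2] forces [r < 2 / 3], so [2 - r > 4 / 3], and [e14] suffices. *)
exists 0; split; rewrite ?lexx ?ler01// subr0 expr1n mul0r subr0.
have : r * expR (- ln r) = 1 by rewrite expRN lnK ?posrE ?mulfV ?gt_eqF.
have := expR_ge1Dx (- ln r); nra.
Qed.

(** Hölder's inequality with exponents [1 / l] and [1 / (1 - l)]: once [a] and [b] are absorbed into
    the exponents as [ln a] and [ln b], it is pointwise convexity of the exponential. If [a = 0],
    then [l = 0] removes the junk value of [ln a]. *)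
Lemma expR_holder (R : realType) (T : finType) (P u v : T -> R) (l a b : R) :
  0 <= l <= 1 -> (forall x, 0 <= P x) -> 0 <= a -> (a = 0 -> l = 0) -> 0 < b ->
  a * (\sum_x P x * expR (u x)) <= 1 -> b * (\sum_x P x * expR (v x)) <= 1 ->
  expR (l * ln a + (1 - l) * ln b) *
    (\sum_x P x * expR (l * u x + (1 - l) * v x)) <= 1.
Proof.
move=> l01 P0; rewrite le_eqVlt => /predU1P[<-|a0] al b0 au bv.
  rewrite al//; under eq_bigr do rewrite mul0r add0r subr0 mul1r.
  by rewrite mul0r add0r subr0 mul1r lnK.
apply: (@le_trans _ _ (l * (a * (\sum_x P x * expR (u x))) +
    (1 - l) * (b * (\sum_x P x * expR (v x))))); last first.
  move: au bv; move: (a * _) (b * _) => y z; case/andP: l01; nra.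
rewrite !mulr_sumr -big_split/=; apply: ler_sum => x _.
rewrite mulrCA -expRD.
have -> : l * ln a + (1 - l) * ln b + (l * u x + (1 - l) * v x) =
  l * (ln a + u x) + (1 - l) * (ln b + v x) by ring.
apply: le_trans (ler_wpM2l (P0 x) (convex_expR_le _ _ l01)) _.
rewrite !expRD !lnK// le_eqVlt; apply/orP; left; apply/eqP; ring.
Qed.

(** * Product measures and Talagrand's convex distance inequality *)

Definition tmass (R : realType) (T : finType) (n : nat) (w : 'I_n -> T -> R)
  (x : n.-tuple T) : R := \prod_i w i (tnth x i).

Lemma tmass_cons (R : realType) (T : finType) (n : nat) (w : 'I_n.+1 -> T -> R)
    (c : T) (x : n.-tuple T) :
  tmass w [tuple of c :: x] = w ord0 c * tmass (fun i => w (lift ord0 i)) x.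
Proof.
by rewrite /tmass big_ord_recl; congr (_ * _); apply: eq_bigr => i _; rewrite tnthS.
Qed.

Lemma tmass_ge0 (R : realType) (T : finType) (n : nat) (w : 'I_n -> T -> R) x :
  (forall i c, 0 <= w i c) -> 0 <= tmass w x.
Proof. by move=> w0; apply: prodr_ge0. Qed.

Lemma sum_tuple_cons (R : realType) (T : finType) (n : nat)
    (F : n.+1.-tuple T -> R) :
  \sum_x F x = \sum_c \sum_(x : n.-tuple T) F [tuple of c :: x].
Proof.
rewrite pair_bigA/=.
rewrite (reindex (fun q : T * n.-tuple T => [tuple of q.1 :: q.2]))//=.
exists (fun x => (thead x, [tuple of behead x])) => [[c x] _|x _] /=.
  by congr (_, _); apply: val_inj.
by rewrite -tuple_eta.
Qed.

Lemma tmass_sum1 (R : realType) (T : finType) (n : nat) (w : 'I_n -> T -> R) :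
  (forall i, \sum_c w i c = 1) -> \sum_x tmass w x = 1.
Proof.
elim: n w => [|n IH] w w1.
  rewrite (bigD1 [tuple])//= big1 ?addr0 => [|x /negP[]]; first exact: big_ord0.
  by rewrite tuple0.
rewrite sum_tuple_cons.
under eq_bigr do under eq_bigr do rewrite tmass_cons.
under eq_bigr do rewrite -mulr_sumr IH// mulr1.
exact: w1.
Qed.

(* [s x] plays the role of a point of the convex hull of the mismatch vectors
   between [x] and the points of [A]; only its dual characterization is used,
   namely that no nonnegative weighting [al] separates it from all of them.
   The induction on [n] mixes the vectors obtained from a section of [A] and
   from the projection of [A], with the weight of [talagrand_lambda]. *)
Lemma talagrand (R : realType) (T : finType) (n : nat) (w : 'I_n -> T -> R) :
  (forall i c, 0 <= w i c) -> (forall i, \sum_c w i c = 1) ->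
  forall A : {set n.-tuple T}, exists s : n.-tuple T -> 'I_n -> R,
  (0 < \sum_(y in A) tmass w y -> forall x (al : 'I_n -> R), (forall i, 0 <= al i) ->
    exists2 y, y \in A &
      \sum_i al i * (tnth x i != tnth y i)%:R <= \sum_i al i * s x i) /\
  (\sum_(y in A) tmass w y) *
    (\sum_x tmass w x * expR ((\sum_i s x i ^+ 2) / 4)) <= 1.
Proof.
elim: n w => [|n IH] w w0 w1 A.
  exists (fun _ _ => 0); split=> [A0 x al _|].
    have [A_eq0|[y yA]] := set_0Vmem A; first by rewrite A_eq0 big_set0 ltxx in A0.
    by exists y => //; rewrite !big_ord0.
  under [X in _ * X]eq_bigr do rewrite big_ord0 mul0r expR0 mulr1.
  rewrite tmass_sum1// mulr1 -(tmass_sum1 w1)// [leRHS](bigID (mem A))/= lerDl.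
  by apply: sumr_ge0 => x _; apply: tmass_ge0.
have [A0|A0] := ltP 0 (\sum_(y in A) tmass w y); last first.
  exists (fun _ _ => 0); split=> //.
  apply: le_trans ler01; apply: mulr_le0_ge0 => //.
  by apply: sumr_ge0 => x _; rewrite mulr_ge0 ?tmass_ge0 ?expR_ge0.
pose w' i := w (lift ord0 i); rewrite -/w'.
have w'0 i c : 0 <= w' i c by exact: w0.
have w'1 i : \sum_c w' i c = 1 by exact: w1.
(* The induction hypothesis is needed for every section and for the projection, hence for all sets
   at once. *)
have [S SP] := choice (IH w' w'0 w'1).
pose sec c : {set n.-tuple T} := [set x : n.-tuple T | [tuple of c :: x] \in A].
pose B : {set n.-tuple T} := \bigcup_c sec c.
pose a c := \sum_(y in sec c) tmass w' y.
pose b := \sum_(y in B) tmass w' y.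
have a0 c : 0 <= a c by apply: sumr_ge0 => x _; apply: tmass_ge0.
have ab c : a c <= b.
  have /setIidPr secB : sec c \subset B by exact: bigcup_sup.
  rewrite /a /b [leRHS](big_setID (sec c))/= secB lerDl.
  by apply: sumr_ge0 => x _; apply: tmass_ge0.
have PA : \sum_(y in A) tmass w y = \sum_c w ord0 c * a c.
  rewrite big_mkcond sum_tuple_cons; apply: eq_bigr => c _.
  rewrite /a mulr_sumr [RHS]big_mkcond/=; apply: eq_bigr => x _.
  by rewrite inE; case: ifP => // _; rewrite tmass_cons.
rewrite PA in A0 *; set pA := \sum_c _ in A0 *.
have pAb : pA <= b.
  rewrite -[b]mul1r -(w1 ord0) mulr_suml; apply: ler_sum => c _.
  by rewrite ler_wpM2l.
have b0 : 0 < b by exact: lt_le_trans pAb.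
have r01 c : 0 <= a c / b <= 1.
  by rewrite divr_ge0 ?(ltW b0)//= ler_pdivrMr// mul1r.
have [l lP] := choice (fun c => talagrand_lambda (r01 c)).
have l01 c : 0 <= l c <= 1 by case: (lP c).
pose s c x j := l c * S (sec c) x j + (1 - l c) * S B x j.
(* Coordinate 0 gets [1 - l c]: a point coming from the projection [B] may differ from [x] there, a
   point of the section does not. *)
exists (fun x i => if unlift ord0 i is Some j
                   then s (thead x) [tuple of behead x] j else 1 - l (thead x)).
have behK c (x : n.-tuple T) : [tuple of behead [tuple of c :: x]] = x.
  exact: val_inj.
split=> [_ x al al0|].
  case/tupleP: x => c x; rewrite big_ord_recl/= unlift_none theadE behK.
  under eq_bigr do rewrite liftK.
  set al' := fun i => al (lift ord0 i).
  have al'0 i : 0 <= al' i by exact: al0.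
  have sE : \sum_i al' i * s c x i = l c * (\sum_i al' i * S (sec c) x i) +
      (1 - l c) * (\sum_i al' i * S B x i).
    rewrite !mulr_sumr -big_split/=; apply: eq_bigr => i _; rewrite /s; ring.
  rewrite {}sE.
  have [y2 /bigcupP[c2 _]] := (SP B).1 b0 x al' al'0.
  rewrite inE => y2A y2le.
  have cost2 : \sum_i al i * (tnth [tuple of c :: x] i != tnth [tuple of c2 :: y2] i)%:R
      <= al ord0 + \sum_i al' i * S B x i.
    rewrite big_ord_recl lerD//.
      by case: (_ != _); rewrite ?mulr1 ?mulr0.
    by under eq_bigr do rewrite !tnthS.
  (* A null section may be empty, but then [l c = 0] and the point from the projection is enough. *)
  have [ac0|ac0] := ltP 0 (a c); last first.
    have lc0 : l c = 0.
      case: (lP c) => _ + _; apply; have -> : a c = 0 by apply/le_anti; rewrite ac0 a0.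
      by rewrite mul0r.
    by exists [tuple of c2 :: y2] => //; rewrite lc0 subr0 mul0r add0r mul1r mulr1.
  have [y1] := (SP (sec c)).1 ac0 x al' al'0.
  rewrite inE => y1A y1le.
  have cost1 : \sum_i al i * (tnth [tuple of c :: x] i != tnth [tuple of c :: y1] i)%:R
      <= \sum_i al' i * S (sec c) x i.
    rewrite big_ord_recl eqxx mulr0 add0r.
    by under eq_bigr do rewrite !tnthS.
  move: cost1 cost2; set m1 := \sum_i al i * _; set m2 := \sum_i al i * _.
  move: (\sum_i al' i * S (sec c) x i) (\sum_i al' i * S B x i) => z1 z2 m1z m2z.
  have /andP[lc0 lc1] := l01 c.
  (* The smaller of the two costs is at most their average with weights [l c] and [1 - l c]. *)
  have [m12|m21] := leP m1 m2.
    by exists [tuple of c :: y1] => //; rewrite -/m1; nra.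
  by exists [tuple of c2 :: y2] => //; rewrite -/m2; nra.
(* Hölder between section and projection leaves the factor [expR ((1 - l c) ^+ 2 / 4 - l c * ln (a c
   / b))], which the choice of [l c] bounds. *)
have step c : b * (\sum_(x : n.-tuple T) tmass w' x *
    expR ((\sum_j s c x j ^+ 2 + (1 - l c) ^+ 2) / 4)) <= 2 - a c / b.
  have [_ lr rl] := lP c.
  have acl : a c = 0 -> l c = 0 by move=> ac0; apply: lr; rewrite ac0 mul0r.
  apply: le_trans rl.
  have := expR_holder (l01 c) (fun x => tmass_ge0 x w'0)
    (a0 c) acl b0 (SP (sec c)).2 (SP B).2.
  have -> : l c * ln (a c) + (1 - l c) * ln b = l c * ln (a c / b) + ln b.
    have [/acl->|ac0] := eqVneq (a c) 0; first by ring.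
    by rewrite ln_div ?posrE// ?lt0r ?ac0 ?a0//; ring.
  rewrite expRD lnK// => H.
  rewrite expRD expRN ler_pdivlMr ?expR_gt0//.
  have hs x : \sum_j s c x j ^+ 2 <= l c * (\sum_j S (sec c) x j ^+ 2) +
      (1 - l c) * (\sum_j S B x j ^+ 2).
    rewrite !mulr_sumr -big_split/=; apply: ler_sum => j _.
    rewrite -subr_ge0 /s; move: (l01 c) => /andP[lc0 lc1].
    move: (S _ x j) (S B x j) => y z.
    have -> : l c * y ^+ 2 + (1 - l c) * z ^+ 2 - (l c * y + (1 - l c) * z) ^+ 2 =
      l c * (1 - l c) * (y - z) ^+ 2 by ring.
    by rewrite mulr_ge0 ?sqr_ge0// mulr_ge0// subr_ge0.
  have {}hs : \sum_x tmass w' x * expR ((\sum_j s c x j ^+ 2 + (1 - l c) ^+ 2) / 4) <=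
      expR ((1 - l c) ^+ 2 / 4) * (\sum_x tmass w' x *
        expR (l c * ((\sum_i S (sec c) x i ^+ 2) / 4) +
          (1 - l c) * ((\sum_i S B x i ^+ 2) / 4))).
    rewrite mulr_sumr; apply: ler_sum => x _; rewrite mulrCA -expRD.
    by rewrite ler_wpM2l ?tmass_ge0// ler_expR; have := hs x; lra.
  apply: le_trans (ler_wpM2r (expR_ge0 _) (ler_wpM2l (ltW b0) hs)) _.
  rewrite -[leRHS]mulr1; apply: le_trans (ler_wpM2l (expR_ge0 _) H).
  by rewrite le_eqVlt; apply/orP; left; apply/eqP; ring.
rewrite sum_tuple_cons.
rewrite (eq_bigr (fun c => w ord0 c * (\sum_(x : n.-tuple T) tmass w' x *
    expR ((\sum_j s c x j ^+ 2 + (1 - l c) ^+ 2) / 4)))); last first.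
  move=> c _; rewrite mulr_sumr; apply: eq_bigr => x _.
  rewrite tmass_cons -mulrA; congr (_ * (_ * expR (_ / 4))).
  rewrite big_ord_recl unlift_none theadE addrC; congr (_ + _).
  by apply: eq_bigr => j _; rewrite liftK behK.
set Q := \sum_c _ * _.
have bQ : b * Q <= 2 - pA / b.
  have -> : 2 - pA / b = \sum_c w ord0 c * (2 - a c / b).
    under eq_bigr do rewrite mulrBr mulrA.
    by rewrite sumrB -mulr_suml w1 mul1r -mulr_suml.
  by rewrite mulr_sumr; apply: ler_sum => c _; rewrite mulrCA ler_wpM2l.
(* With [rho = pA / b], what remains is [rho * (2 - rho) <= 1]. *)
have -> : pA = pA / b * b by rewrite divfK ?gt_eqF.
have : 0 <= pA / b by rewrite divr_ge0 ?ltW.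
rewrite -mulrA; move: (pA / b) (b * Q) bQ => rho q qle rho0.
have := ler_wpM2l rho0 qle; have := sqr_ge0 (rho - 1); lra.
Qed.

(** For [x] in [C], weighting by the indicator of [B] shows that [s x] sums to at least
    [t * Num.sqrt m%:R] over [B]. By Cauchy-Schwarz its squares then sum to at least [t ^+ 2], and
    Markov's inequality concludes. *)
Lemma talagrand_separated (R : realType) (T : finType) (n m : nat)
    (w : 'I_n -> T -> R) (t : R) (A C : {set n.-tuple T}) :
  (forall i c, 0 <= w i c) -> (forall i, \sum_c w i c = 1) ->
  (0 < m)%N -> 0 < t ->
  (forall x, x \in C -> exists2 B : {set 'I_n}, #|B| = m &
    forall y, y \in A ->
      t * Num.sqrt m%:R <= #|[set i in B | tnth x i != tnth y i]|%:R) ->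
  (\sum_(y in A) tmass w y) * (\sum_(x in C) tmass w x) <= expR (- (t ^+ 2 / 4)).
Proof.
move=> w0 w1 m0 t0 sep.
have [A0|A0] := ltP 0 (\sum_(y in A) tmass w y); last first.
  apply: le_trans (expR_ge0 _); apply: mulr_le0_ge0 => //.
  by apply: sumr_ge0 => x _; apply: tmass_ge0.
have [s [/(_ A0) sA sle]] := talagrand w0 w1 A.
rewrite expRN -[leRHS]mul1r ler_pdivlMr ?expR_gt0// -mulrA.
apply: le_trans sle; rewrite ler_wpM2l ?(ltW A0)// mulr_suml big_mkcond.
apply: ler_sum => x _; case: ifPn => [xC|_]; last by rewrite mulr_ge0 ?tmass_ge0 ?expR_ge0.
rewrite ler_wpM2l ?tmass_ge0// ler_expR ler_pM2r ?invr_gt0//.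
have [B Bm sepB] := sep x xC.
have [|y /sepB ty] := sA x (fun i => (i \in B)%:R); first by move=> i; rewrite ler0n.
have -> : \sum_i (i \in B)%:R * (tnth x i != tnth y i)%:R =
    #|[set i in B | tnth x i != tnth y i]|%:R :> R.
  rewrite -sum1_card natr_sum [RHS]big_mkcond; apply: eq_bigr => i _.
  by rewrite inE; case: (i \in B); case: (_ != _); rewrite ?mulr1 ?mulr0 ?mul0r.
move=> /(le_trans ty).
have -> : \sum_i (i \in B)%:R * s x i = \sum_(i in B) s x i.
  by rewrite [RHS]big_mkcond; apply: eq_bigr => i _; case: (i \in B); rewrite ?mul1r ?mul0r.
set q := Num.sqrt _ => tq.
have q0 : 0 < q by rewrite sqrtr_gt0 ltr0n.
have qq : q ^+ 2 = m%:R by rewrite sqr_sqrtr ?ler0n.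
(* sum the tangent-line bounds [2 c s - c ^ 2 <= s ^ 2] at [c = t / sqrt m] *)
pose c := t / q.
have c0 : 0 < c by rewrite divr_gt0.
apply: (@le_trans _ _ (\sum_(i in B) (2 * c * s x i - c ^+ 2))); last first.
  rewrite big_mkcond; apply: ler_sum => i _; case: ifP => _; last exact: sqr_ge0.
  by have := sqr_ge0 (s x i - c); lra.
rewrite sumrB -mulr_sumr sumr_const Bm -[c ^+ 2 *+ _]mulr_natr -qq.
have -> : c ^+ 2 * q ^+ 2 = t ^+ 2 by rewrite -exprMn divfK ?gt_eqF.
have tE : t = c * q by rewrite divfK ?gt_eqF.
by have := ler_wpM2l (ltW c0) tq; rewrite {3}tE; nra.
Qed.

(** * The random graph as a product of independent rows *)

Definition rows (n : nat) (G : graph n) : n.-tuple {set 'I_n} :=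
  [tuple [set i | (i, j) \in val G] | j < n].

Lemma graph_of_rows_sub (n : nat) (x : n.-tuple {set 'I_n}) :
  [set e : 'I_n * 'I_n | (e.1 < e.2)%N && (e.1 \in tnth x e.2)] \subset edge_slots n.
Proof. by apply/subsetP => e; rewrite !inE => /andP[]. Qed.

Definition graph_of_rows (n : nat) (x : n.-tuple {set 'I_n}) : graph n :=
  exist (fun G : {set _} => is_true (G \subset edge_slots n)) _ (graph_of_rows_sub x).

Lemma rowsK (n : nat) : cancel (@rows n) (@graph_of_rows n).
Proof.
move=> G; apply/val_inj/setP => -[i j]; rewrite inE tnth_mktuple inE/=.
by apply: andb_idl => /(subsetP (valP G)); rewrite inE.
Qed.

(** Rows share one type so as to form a tuple, hence row [j] may list some [i >= j]; such rows get
    mass 0. *)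
Definition row_mass (R : realType) (n : nat) (p : R) (j : 'I_n) (S : {set 'I_n}) : R :=
  \prod_i (if i \in S then if (i < j)%N then p else 0
           else if (i < j)%N then 1 - p else 1).

Lemma row_mass_ge0 (R : realType) (n : nat) (p : R) (j : 'I_n) (S : {set 'I_n}) :
  0 <= p <= 1 -> 0 <= row_mass p j S.
Proof.
move=> /andP[p0 p1]; apply: prodr_ge0 => i _.
by do 2 case: ifP => _ //; rewrite subr_ge0.
Qed.

Lemma row_mass_sum1 (R : realType) (n : nat) (p : R) (j : 'I_n) :
  \sum_S row_mass p j S = 1.
Proof.
transitivity (\prod_(i < n)
    ((if (i < j)%N then p else 0) + (if (i < j)%N then 1 - p else 1))).
  by rewrite bigA_distr.
rewrite big1// => i _.
by case: ifP; rewrite ?subrKC ?add0r.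
Qed.

Lemma gnp_prob_rows (R : realType) (n : nat) (p : R) (E : pred (graph n)) :
  gnp_prob p E =
  \sum_(x in [set x | E (graph_of_rows x)]) tmass (@row_mass R n p) x.
Proof.
rewrite /gnp_prob (reindex_onto (@graph_of_rows n) (@rows n)); last first.
  by move=> G _; apply: rowsK.
under [RHS]eq_bigl do rewrite inE.
(* Tuples that are not the rows of a graph have mass 0. *)
rewrite [RHS](bigID (fun x => rows (graph_of_rows x) == x))/=.
rewrite [X in _ = _ + X]big1 ?addr0 => [|x /andP[_]]; last first.
  apply: contraNeq => x_neq0; apply/eqP/eq_from_tnth => j.
  apply/setP => i; rewrite tnth_mktuple !inE/=; apply: andb_idl => iS.
  apply: contraNT x_neq0 => ij; apply/eqP.
  by rewrite /tmass (bigD1 j)//= /row_mass (bigD1 i)//= iS (negbTE ij) !mul0r.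
apply: eq_bigr => x /andP[_ /eqP xE].
rewrite /gnp_mass /tmass /row_mass exchange_big pair_bigA big_mkcond/=.
apply: eq_bigr => -[i j] _ /=; rewrite !inE/=.
case: ltnP => //= ij; case: ifP => // iS.
by move: iS; rewrite -xE tnth_mktuple !inE/= ltnNge ij.
Qed.

(** * Covers by independent sets *)

Lemma chi_le (n : nat) (G : graph n) (A : {set 'I_n}) (C : {set {set 'I_n}}) :
  {in C, forall S, independent G S} -> A \subset cover C -> (chi G A <= #|C|)%N.
Proof.
move=> indC AC; rewrite /chi; case: ex_minnP => c _; apply.
by apply/existsP; exists C; rewrite eqxx AC andbT; apply/forall_inP.
Qed.

Lemma chi_cover (n : nat) (G : graph n) (A : {set 'I_n}) :
  exists C : {set {set 'I_n}}, [/\ #|C| = chi G A,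
    {in C, forall S, independent G S} & A \subset cover C].
Proof.
rewrite /chi; case: ex_minnP => c /existsP[C /and3P[/eqP Cc /forall_inP indC AC]] _.
by exists C.
Qed.

(** Cut an optimal cover of [A] for [G] down to [A :\: D], where its sets stay independent in [H],
    and add an optimal cover of [A :&: D] for [H]. *)
Lemma chi_perturb (n : nat) (G H : graph n) (A D : {set 'I_n}) :
  {in A :\: D &, forall i j, ((i, j) \in val H) -> ((i, j) \in val G)} ->
  (chi H A <= chi G A + chi H (A :&: D))%N.
Proof.
move=> GH; have [C1 [<- ind1 cov1]] := chi_cover G A.
have [C2 [<- ind2 cov2]] := chi_cover H (A :&: D).
pose C := [set S :&: (A :\: D) | S in C1] :|: C2.
apply: (@leq_trans #|C|); last first.
  by rewrite (leq_trans (leq_card_setU _ _))// leq_add2r leq_imset_card.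
apply: chi_le => [S|].
  rewrite inE => /orP[/imsetP[S1 S1C ->]|]; last exact: ind2.
  apply/forall_inP => i; rewrite inE => /andP[iS iA].
  apply/forall_inP => j; rewrite inE => /andP[jS jA].
  by apply: contra (GH i j iA jA) _; move/forall_inP: (ind1 _ S1C) => /(_ i iS)/forall_inP; apply.
apply/subsetP => i iA; have [iD|iD] := boolP (i \in D).
  have /(subsetP cov2)/bigcupP[S SC iS] : i \in A :&: D by rewrite inE iA.
  by apply/bigcupP; exists S; rewrite // inE SC orbT.
have /bigcupP[S SC iS] := subsetP cov1 i iA.
apply/bigcupP; exists (S :&: (A :\: D)); last by rewrite !inE iS iD iA.
by rewrite inE; apply/orP; left; apply/imsetP; exists S.
Qed.

Lemma chi_inf_le (n : nat) (G : graph n) (A : {set 'I_n}) :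
  (chi_inf G #|A| <= chi G A)%N.
Proof.
rewrite /chi_inf; elim: (index_enum _) (mem_index_enum A) => // B s IH.
rewrite inE big_cons => /predU1P[<-|/IH As]; first by rewrite eqxx geq_minl.
by case: ifP => // _; rewrite geq_min As orbT.
Qed.

Lemma chi_inf_le_n (n : nat) (G : graph n) (m : nat) : (chi_inf G m <= n)%N.
Proof.
by rewrite /chi_inf; elim/big_rec: _ => // A c _ cn; rewrite geq_min cn orbT.
Qed.

Lemma chi_inf_attained (n : nat) (G : graph n) (m : nat) : (m <= n)%N ->
  exists2 A : {set 'I_n}, #|A| = m & (chi G A <= chi_inf G m)%N.
Proof.
move=> mn; rewrite /chi_inf; elim/big_rec: _ => [|A c /eqP Am [B Bm Bc]].
  (* Since [m <= n], some set has size [m]; its [chi] is at most the default value [n]. *)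
  have /card_gt0P[A] : (0 < #|[set A : {set 'I_n} | #|A| == m]|)%N.
    by rewrite card_draws card_ord bin_gt0.
  rewrite inE => /eqP Am.
  by exists A => //; apply: chi_le_n.
by have [Ac|cA] := leqP (chi G A) c; [exists A|exists B].
Qed.

(** * Talagrand's inequality applied to the chromatic number *)

Lemma gnp_prob_chi_separated (R : realType) (n : nat) (p : R) (m k b : nat) (t : R) :
  0 < p < 1 -> (0 < m <= n)%N -> 0 < t ->
  gnp_prob p (fun G : graph n =>
      (b + k < chi_inf G m)%N && (chi_sup G (t * Num.sqrt m%:R) <= k)%N) *
    gnp_prob p (fun G : graph n => (chi_inf G m <= b)%N) <= expR (- (t ^+ 2 / 4)).
Proof.
move=> /andP[p0 p1] /andP[m0 mn] t0; rewrite !gnp_prob_rows.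
apply: (@talagrand_separated _ _ _ m) => // [i c|i|x].
- by rewrite row_mass_ge0// !ltW.
- exact: row_mass_sum1.
rewrite inE => xb; have [B Bm Bchi] := chi_inf_attained (graph_of_rows x) mn.
exists B => // y; rewrite inE => /andP[yb yk].
(* [F] holds the vertices of [B] whose rows differ; were it small, [k] independent sets would cover
   it in the graph of [y]. *)
set F := [set i in B | _]; rewrite leNgt; apply/negP => /ltW Fm.
have Fk : (chi (graph_of_rows y) F <= k)%N.
  by apply: leq_trans yk; rewrite /chi_sup (bigD1 F)//= leq_maxl.
have := @chi_perturb _ (graph_of_rows x) (graph_of_rows y) B F.
have -> : B :&: F = F by apply/setIidPr/subsetP => i; rewrite inE => /andP[].
move=> yB; move: yb; rewrite ltnNge => /negP; apply.
rewrite -Bm (leq_trans (chi_inf_le _ _))// (leq_trans (yB _))//.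
  (* The edge [(i, j)] is recorded in row [j], so it is enough that the rows agree at [j]. *)
  move=> i j _; rewrite !inE/= => /andP[jF jB].
  by move: jF; rewrite jB/= negbK => /eqP ->.
by rewrite leq_add// (leq_trans Bchi).
Qed.

(** * Elementary probability and the choice of the interval *)

Lemma gnp_mass_ge0 (R : realType) (n : nat) (p : R) (G : graph n) :
  0 <= p <= 1 -> 0 <= gnp_mass p G.
Proof.
by move=> /andP[p0 p1]; apply: prodr_ge0 => e _; case: ifP; rewrite ?subr_ge0.
Qed.

Lemma gnp_prob_ge0 (R : realType) (n : nat) (p : R) (E : pred (graph n)) :
  0 <= p <= 1 -> 0 <= gnp_prob p E.
Proof. by move=> p01; apply: sumr_ge0 => G _; apply: gnp_mass_ge0. Qed.

Lemma gnp_prob_true (R : realType) (n : nat) (p : R) (E : pred (graph n)) :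
  (forall G, E G) -> gnp_prob p E = 1.
Proof.
move=> ET; have := @gnp_prob_edges R n p set0 (sub0set _).
rewrite cards0 expr0 => <-; apply: eq_bigl => G; by rewrite ET sub0set.
Qed.

Lemma gnp_prob_leU (R : realType) (n : nat) (p : R) (E E1 E2 : pred (graph n)) :
  0 <= p <= 1 -> (forall G, E G -> E1 G || E2 G) ->
  gnp_prob p E <= gnp_prob p E1 + gnp_prob p E2.
Proof.
move=> p01 EU; rewrite /gnp_prob big_mkcond [X in _ <= X + _]big_mkcond.
rewrite [X in _ <= _ + X]big_mkcond -big_split/=; apply: ler_sum => G _.
have := gnp_mass_ge0 G p01; have := EU G.
by case: (E G) (E1 G) (E2 G) => [] [] [] //= EG; first [lra|have := EG isT].
Qed.

Unset Implicit Arguments.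

Theorem theorem9p1 (R : realType) (n : nat) (p : R) (m k : nat) (t : R)
    (hn : (1 <= n)%N) (hp0 : 0 < p) (hp1 : p < 1)
    (hm1 : (1 <= m)%N) (hmn : (m <= n)%N) (ht : 0 < t) :
  exists a : int,
    gnp_prob p (fun G : graph n => a - k%:Z <= (chi_inf G m)%:Z <= a) >=
      1 - 2 * expR (- (t ^+ 2 / 8))
        - gnp_prob p (fun G : graph n => (chi_sup G (t * Num.sqrt m%:R) > k)%N).
Proof.
have p01 : 0 <= p <= 1 by rewrite !ltW.
set q := expR (- (t ^+ 2 / 8)).
have q0 : 0 < q by exact: expR_gt0.
have q1 : q < 1 by rewrite expR_lt1 oppr_lt0 divr_gt0 ?exprn_gt0.
have exb : exists b, q < gnp_prob p (fun G : graph n => (chi_inf G m <= b)%N).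
  by exists n; rewrite gnp_prob_true// => G; apply: chi_inf_le_n.
case: (ex_minnP exb) => b qb bmin.
exists (b + k)%N%:Z.
(* By minimality of [b]; for [b = 0] the event is empty. *)
have ltb : gnp_prob p (fun G : graph n => (chi_inf G m < b)%N) <= q.
  case: b bmin {qb} => [|b] bmin; first by rewrite /gnp_prob big_pred0// ltW.
  by rewrite leNgt; apply/negP => /bmin; rewrite ltnn.
set sup := gnp_prob p (fun G => (k < _)%N).
set bad := fun G : graph n =>
  (b + k < chi_inf G m)%N && (chi_sup G (t * Num.sqrt m%:R) <= k)%N.
have badq : gnp_prob p bad <= q.
  have := @gnp_prob_chi_separated R n p m k b t.
  rewrite hp0 hp1 hm1 hmn => /(_ isT isT ht); rewrite -/bad.
  have -> : expR (- (t ^+ 2 / 4)) = q * q by rewrite -expRD; congr expR; field.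
  (* The product with a probability exceeding [q] is at most [q * q]. *)
  by have := gnp_prob_ge0 bad p01; nra.
set good := gnp_prob p (fun G => _ <= _ <= _).
(* Four events cover all graphs: [chi_inf G m < b], [bad], [chi_sup] above [k], and
   [b <= chi_inf G m <= b + k]. The first two have probability at most [q] each. *)
suff : 1 <= gnp_prob p (fun G : graph n => (chi_inf G m < b)%N) +
    (gnp_prob p bad + (sup + good)) by lra.
rewrite -[leLHS](@gnp_prob_true R n p xpredT)//.
apply: le_trans (gnp_prob_leU (E1 := fun G => (chi_inf G m < b)%N)
  (E2 := fun G => (b <= chi_inf G m)%N) p01 _) _ => [G _|].
  by rewrite ltnNge orNb.
rewrite lerD2l.
apply: le_trans (gnp_prob_leU (E1 := bad)
  (E2 := fun G => (b <= chi_inf G m)%N && ~~ bad G) p01 _) _ => [G ->|].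
  by rewrite orbN.
rewrite lerD2l; apply: gnp_prob_leU => // G /andP[bG].
rewrite negb_and -leqNgt -ltnNge orbC => /orP[->//|Gbk].
apply/orP; right; rewrite PoszD addrK lez_nat bG.
by rewrite -PoszD lez_nat.
Qed.
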